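(* Let $f=\frac1N\sum_{j=1}^N f_j$ on the Riemannian manifold $\mathcal M$ satisfy the retraction smoothness assumption with constant $L_r>0$ and the bounded variance estimator assumption with constant $\sigma>0$ (both stated in the context). Let $K',l,l_w\in\mathbb N$ (positive integers) with $l_w\ge l$, $K=lK'$, $T_w=l_wK'$, and let $T>T_w$ be the total number of iterations. Consider one of the following two choices of batch size and warm-up learning rate: (E) exponential: $b_t=b_0\gamma^{\lfloor t/K\rfloor}$ for $0\le t<T$ and $\eta_t=\eta_0\delta^{\lfloor t/K'\rfloor}$ for $0\le t<T_w$, where $b_0,\eta_0>0$, $\gamma,\delta>1$ and $\delta^{2l}<\gamma$; (P) polynomial: $b_t=(a\lfloor t/K\rfloor+b_0)^c$ for $0\le t<T$ and $\eta_t=(s\lfloor t/K'\rfloor+\eta_0)^q$ for $0\le t<T_w$, where $b_0,\eta_0,a,s>0$ and $c,q>1$. Put $\eta_{\max}=\eta_{T_w-1}$, assume $\eta_{\max}<\frac2{L_r}$, and let $0\le\eta_{\min}\le\eta_{\max}$, $p>0$. For $T_w\le t\le T-1$ let the learning rate (decay part) be one of: (1) constant: $\eta_t=\eta_{\max}$; (2) diminishing: $\eta_t=\frac{\eta_{\max}}{\sqrt{t+1}}$; (3) cosine annealing: $\eta_t=\eta_{\min}+\frac{\eta_{\max}-\eta_{\min}}2\left(1+\cos\frac{t-T_w}{T-T_w}\pi\right)$; (4) polynomial decay: $\eta_t=\eta_{\min}+(\eta_{\max}-\eta_{\min})\left(1-\frac{t-T_w}{T-T_w}\right)^p$. Let $(x_t)_t$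 be generated by RSGD with these batch sizes and learning rates, and let $\|G_T\|^2=\min_{t\in\{0,\dots,T-1\}}\mathbb E[\|\mathrm{grad}f(x_t)\|_{x_t}^2]$. Then, in both cases (E) and (P): (I) for the decay part (2), $\|G_T\|^2=O\left((\sqrt{T+1}-\sqrt{T_w+1})^{-1}\right)$; (II) for each of the decay parts (1), (3), (4), $\|G_T\|^2=O\left((T-T_w)^{-1}\right)$.
   Context: $\mathcal M$ is a Riemannian manifold with inner product $\langle\cdot,\cdot\rangle_x$ and norm $\|\cdot\|_x$ on the tangent space $T_x\mathcal M$; $\mathrm{grad}$ denotes the Riemannian gradient. A retraction is a map $R\colon T\mathcal M\ni(x,v)\mapsto R_x(v)\in\mathcal M$ with $R_x(0_x)=x$ and $DR_x(0_x)=\mathrm{id}_{T_x\mathcal M}$ (identifying $T_{0_x}T_x\mathcal M\simeq T_x\mathcal M$) for all $x\in\mathcal M$; a retraction $R$ on $\mathcal M$ is fixed. Each $f_j\colon\mathcal M\to\mathbb R$ ($j=1,\dots,N$) is smooth and bounded below, and $f=\frac1N\sum_{j=1}^Nf_j$. Retraction smoothness: there is $L_r>0$ such that $f(R_x(v))\le f(x)+\langle\mathrm{grad}f(x),v\rangle_x+\frac{L_r}{2}\|v\|_x^2$ for all $x\in\mathcal M$, $v\in T_x\mathcal M$. Bounded variance estimator: $\Pi$ is a probability distribution on $\{1,\dots,N\}$ with (I) $\mathbb E_{\xi\sim\Pi}[\mathrm{grad}f_\xi(x)]=\mathrm{grad}f(x)$ for all $x\in\mathcal M$, and (II) there is $\sigma>0$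 with $\mathbb E_{\xi\sim\Pi}[\|\mathrm{grad}f_\xi(x)-\mathrm{grad}f(x)\|_x^2]\le\sigma^2$ for all $x\in\mathcal M$. RSGD (Riemannian stochastic gradient descent) with learning rates $\eta_t$ and batch sizes $b_t$ (the schedule parameters are such that all $b_t$ are positive integers): from a given deterministic $x_0\in\mathcal M$, $x_{t+1}=R_{x_t}(-\eta_t\,\mathrm{grad}f_{B_t}(x_t))$, where $\mathrm{grad}f_{B_t}(x)=\frac1{b_t}\sum_{i=1}^{b_t}\mathrm{grad}f_{\xi_{i,t}}(x)$ and $(\xi_{i,t})_{i,t}$ are i.i.d. with law $\Pi$. $\mathbb E$ is the total expectation over all samples. The $O$-notation refers to $T\to\infty$ with all other parameters (including $T_w$, $K$, $K'$) fixed. *)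

(* Defs.v *)
From HB Require Import structures.
From mathcomp Require Export all_boot all_order all_algebra.
From mathcomp Require Export all_classical all_reals all_analysis.

Set Implicit Arguments.
Unset Strict Implicit.
Unset Printing Implicit Defensive.

Export Order.TTheory GRing.Theory Num.Theory.
Export numFieldNormedType.Exports.

Local Open Scope classical_set_scope.
Local Open Scope ring_scope.

(* C^oo on an open set U: all iterated directional derivatives exist and are
   Frechet differentiable (in particular continuous) on U. *)
Definition iter_derive (R : realType) (V W : normedModType R) (f : V -> W)
    (s : seq V) : V -> W :=
  foldr (fun v (h : V -> W) => 'D_v h) f s.

Definition smooth_on (R : realType) (V W : normedModType R) (U : set V)
    (f : V -> W) : Prop :=
  forall (s : seq V) (u : V), U u -> differentiable (iter_derive f s) u.

(* The values of [coord] outside [dom] and of [coordV] outside the image of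
   [dom] are junk. *)
Record chart (R : realType) (n : nat) (M : topologicalType) := Chart {
  dom : set M;
  coord : M -> 'rV[R]_n;
  coordV : 'rV[R]_n -> M;
  dom_open : open dom;
  img_open : open (coord @` dom);
  coordK : forall x, dom x -> coordV (coord x) = x;
  coord_continuous : forall x, dom x -> {for x, continuous coord};
  coordV_continuous :
    forall u, (coord @` dom) u -> {for u, continuous coordV} }.

(* A smooth structure is given by a (not necessarily maximal) atlas. Each point
   x comes with a preferred chart [chart_at x] of the atlas around it, which
   serves to represent the tangent space at x below. *)
Record smoothManifold (R : realType) (n : nat) := SmoothManifold {
  carrier :> topologicalType;
  carrier_hausdorff : hausdorff_space carrier;
  carrier_second_countable : @second_countable carrier;
  atlas : set (chart R n carrier);
  atlas_compatible : forall phi psi, atlas phi -> atlas psi ->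
    smooth_on (coord phi @` (dom phi `&` dom psi)) (coord psi \o coordV phi);
  chart_at : carrier -> chart R n carrier;
  chart_at_atlas : forall x, atlas (chart_at x);
  chart_at_dom : forall x, dom (chart_at x) x }.

(* T_x M is represented by R^n, a tangent vector at x being identified with its
   components in the preferred chart at x. Its components in another chart phi
   around x are obtained by applying the differential at [coord (chart_at x) x]
   of the transition map [coord phi \o coordV (chart_at x)]. *)
Definition tangent (R : realType) (n : nat) (M : smoothManifold R n) (x : M) :=
  'rV[R]_n.

Section Manifold.
Variables (R : realType) (n : nat) (M : smoothManifold R n).

Definition smooth_function (f : M -> R) : Prop :=
  forall phi, @atlas _ _ M phi ->
    smooth_on (coord phi @` dom phi) (f \o coordV phi).

Definition differential (f : M -> R) (x : M) : tangent x -> R :=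
  'd (f \o coordV (chart_at x)) (coord (chart_at x) x).

(* The coordinate vector field d/du_i of the chart phi, at the point of
   coordinates u: its components in the preferred chart of that point. *)
Definition coord_vector (phi : chart R n M) (i : 'I_n) (u : 'rV[R]_n) :
    tangent (coordV phi u) :=
  'd (coord (chart_at (coordV phi u)) \o coordV phi) u (delta_mx 0 i).

End Manifold.

Record riemannianMetric (R : realType) (n : nat) (M : smoothManifold R n) :=
  RiemannianMetric {
    inner : forall x : M, tangent x -> tangent x -> R;
    inner_sym : forall (x : M) (u v : tangent x), inner u v = inner v u;
    inner_linear : forall (x : M) (a : R) (u v w : tangent x),
      inner (a *: u + v) w = a * inner u w + inner v w;
    inner_gt0 : forall (x : M) (v : tangent x), v != 0 -> 0 < inner v v;
    inner_smooth : forall phi, @atlas _ _ M phi -> forall i j : 'I_n,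
      smooth_on (coord phi @` dom phi)
        (fun u => inner (coord_vector phi i u) (coord_vector phi j u) : R) }.

Section Riemannian.
Variables (R : realType) (n : nat) (M : smoothManifold R n).
Variable g : riemannianMetric M.

Definition rnorm (x : M) (v : tangent x) : R := Num.sqrt (inner g v v).

(* The unique w with <w, v>_x = Df(x)[v] for all v; see [gradP]. *)
Definition grad (f : M -> R) (x : M) : tangent x :=
  xget (0 : tangent x)
    [set w : tangent x | forall v : tangent x, inner g w v = differential f v].

(* [Retr x : T_x M -> M] satisfies R_x(0_x) = x and DR_x(0_x) = id, the latter
   expressed in the preferred chart at x. Continuity of R_x at 0_x ensures that
   R_x(v) lies in the domain of this chart for small v. *)
Definition retraction (Retr : forall x : M, tangent x -> M) : Prop :=
  forall x : M,
    let Rx : 'rV[R]_n -> M := Retr x in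
    [/\ Rx 0 = x,
        {for 0, continuous Rx},
        differentiable (coord (chart_at x) \o Rx) 0 &
        forall v, 'd (coord (chart_at x) \o Rx) 0 v = v].

Definition retraction_smooth (Retr : forall x : M, tangent x -> M)
    (f : M -> R) (L : R) : Prop :=
  forall (x : M) (v : tangent x),
    f (Retr x v) <= f x + inner g (grad f x) v + L / 2 * rnorm v ^+ 2.

Definition bounded_below (f : M -> R) : Prop := exists m, forall x, m <= f x.

Definition average (N : nat) (fs : 'I_N -> M -> R) : M -> R :=
  fun x => N%:R^-1 * \sum_(j < N) fs j x.

Definition unbiased (N : nat) (fs : 'I_N -> M -> R) (Pi : 'I_N -> R) : Prop :=
  forall x : M,
    \sum_(j < N) Pi j *: grad (fs j) x = grad (average fs) x :> tangent x.

Definition bounded_variance (N : nat) (fs : 'I_N -> M -> R) (Pi : 'I_N -> R)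
    (sigma : R) : Prop :=
  forall x : M,
    \sum_(j < N)
      Pi j * rnorm (grad (fs j) x - grad (average fs) x : tangent x) ^+ 2
    <= sigma ^+ 2.

End Riemannian.

Section gradP.
Variables (R : realType) (n : nat) (M : smoothManifold R n).
Variable g : riemannianMetric M.

Lemma innerDl (x : M) (u v w : tangent x) :
  inner g (u + v) w = inner g u w + inner g v w.
Proof. by have := inner_linear g 1 u v w; rewrite scale1r mul1r. Qed.

Lemma inner0l (x : M) (w : tangent x) : inner g (0 : tangent x) w = 0.
Proof.
have := innerDl (0 : tangent x) 0 w; rewrite addr0 => /eqP.
by rewrite -subr_eq0 opprD addrA subrr sub0r oppr_eq0 => /eqP.
Qed.

Lemma innerZl (x : M) a (u w : tangent x) :
  inner g (a *: u : tangent x) w = a * inner g u w.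
Proof. by have := inner_linear g a u 0 w; rewrite addr0 inner0l addr0. Qed.

Lemma inner_suml (x : M) (I : finType) (F : I -> tangent x) (w : tangent x) :
  inner g (\sum_i F i : tangent x) w = \sum_i inner g (F i) w.
Proof.
elim/big_rec2: _ => [|i y1 y2 _ <-]; first exact: inner0l.
exact: innerDl.
Qed.

Lemma gradP (f : M -> R) (x : M) (v : tangent x) : smooth_function f ->
  inner g (grad g f x) v = differential f v.
Proof.
move=> sf.
have df : differentiable (f \o coordV (chart_at x)) (coord (chart_at x) x).
  apply: (sf _ (chart_at_atlas x) [::]).
  by exists x => //; exact: chart_at_dom.
pose e (i : 'I_n) : tangent x := delta_mx 0 i.
pose A : 'M[R]_n := \matrix_(i, j) inner g (e i) (e j).
have decomp (w : tangent x) : w = \sum_i w 0 i *: e i :> tangent x.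
  exact: row_sum_delta.
have AE (w : tangent x) j : (w *m A) 0 j = inner g w (e j).
  rewrite [in RHS](decomp w) inner_suml mxE; apply: eq_bigr => i _.
  by rewrite innerZl mxE.
have innerE (w v' : tangent x) : inner g w v' = \sum_j v' 0 j * (w *m A) 0 j.
  rewrite inner_sym [in LHS](decomp v') inner_suml; apply: eq_bigr => j _.
  by rewrite innerZl inner_sym AE.
have Afree : row_free A.
  apply/row_freeP; exists (invmx A); apply: mulmxV.
  rewrite -row_free_unit -kermx_eq0; apply/eqP/row_matrixP => i.
  apply/eqP; rewrite row0; apply: contraT => k0.
  pose w : tangent x := row i (kermx A).
  have := inner_gt0 g (k0 : w != 0).
  rewrite innerE /w -row_mul mulmx_ker row0.
  by rewrite big1 ?ltxx// => j _; rewrite [X in _ * X]mxE mulr0.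
have Aunit : A \in unitmx by rewrite -row_free_unit.
rewrite /grad; case: xgetP => [w _ -> //|/(_ _)/= nog].
pose d : 'rV[R]_n := \row_j differential f (e j).
exfalso; apply: (nog (d *m invmx A)) => v'.
rewrite innerE mulmxKV// [in RHS](decomp v') /differential linear_sum/=.
by apply: eq_bigr => j _; rewrite linearZ/= mxE.
Qed.

End gradP.

Section Probability.
Variables (d : measure_display) (Omega : measurableType d) (R : realType).
Variable P : probability Omega R.

Definition is_distr (J : finType) (Pi : J -> R) : Prop :=
  (forall j, 0 <= Pi j) /\ \sum_j Pi j = 1.

(* Random variables with values in a finite set J, which carries the discrete
   sigma-algebra. *)
Record iid (I : eqType) (J : finType) (Pi : J -> R) (X : I -> Omega -> J) :
    Prop := Iid {
  iid_measurable : forall i (A : set J), measurable (X i @^-1` A);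
  iid_law : forall i (j : J), P (X i @^-1` [set j]) = (Pi j)%:E;
  iid_independent : forall (s : seq I) (A : I -> set J), uniq s ->
    P (\bigcap_(i in [set` s]) (X i @^-1` A i)) =
    (\prod_(i <- s) P (X i @^-1` A i))%E }.

End Probability.

Section RSGD.
Variables (R : realType) (n : nat) (M : smoothManifold R n).
Variable g : riemannianMetric M.
Variables (Retr : forall x : M, tangent x -> M).
Variables (N : nat) (fs : 'I_N -> M -> R).
Variables (Omega : Type) (b : nat -> nat).
Variable xi : forall t : nat, 'I_(b t) -> Omega -> 'I_N.

Definition minibatch_grad (t : nat) (w : Omega) (x : M) : tangent x :=
  (b t)%:R^-1 *: \sum_(i < b t) grad g (fs (xi i w)) x.

Fixpoint rsgd (eta : nat -> R) (x0 : M) (t : nat) (w : Omega) : M :=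
  if t is s.+1 then
    let x := rsgd eta x0 s w in
    @Retr x (- eta s *: minibatch_grad s w x : tangent x)
  else x0.

End RSGD.

(* ||G_T||^2, for the learning rates [eta]; a minimum over a nonempty set as
   soon as T > 0. The expectations are those of random variables taking finitely
   many values, so [fine] never meets an infinite argument. *)
Definition min_sqgrad (R : realType) (n : nat) (M : smoothManifold R n)
    (g : riemannianMetric M) (Retr : forall x : M, tangent x -> M) (N : nat)
    (fs : 'I_N -> M -> R) (d : measure_display) (Omega : measurableType d)
    (P : probability Omega R) (b : nat -> nat)
    (xi : forall t : nat, 'I_(b t) -> Omega -> 'I_N) (x0 : M)
    (eta : nat -> R) (T : nat) : R :=
  let sqgrad t w : R :=
    rnorm g (grad g (average fs) (rsgd g Retr fs xi eta x0 t w)) ^+ 2 in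
  let E t := fine ('E_P[sqgrad t])%E in
  \big[Num.min/E 0%N]_(t < T) E t.

Section Schedules.
Variable R : realType.
Implicit Types (b : nat -> nat) (warm : nat -> R) (K l Tw T t : nat).

Definition exponential_warmup l K (K' : nat) Tw b warm : Prop :=
  exists b0 eta0 gamma delta : R,
    [/\ 0 < b0 /\ 0 < eta0,
        [/\ 1 < gamma, 1 < delta & delta ^+ (2 * l) < gamma],
        forall t, (b t)%:R = b0 * gamma ^+ (t %/ K) &
        forall t, (t < Tw)%N -> warm t = eta0 * delta ^+ (t %/ K')].

Definition polynomial_warmup K (K' : nat) Tw b warm : Prop :=
  exists b0 eta0 a s c q : R,
    [/\ [/\ 0 < b0, 0 < eta0, 0 < a & 0 < s],
        1 < c /\ 1 < q,
        forall t, (b t)%:R = (a * (t %/ K)%:R + b0) `^ c &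
        forall t, (t < Tw)%N -> warm t = (s * (t %/ K')%:R + eta0) `^ q].

Definition decay_constant (eta_max : R) : nat -> R := fun=> eta_max.

Definition decay_diminishing (eta_max : R) : nat -> R :=
  fun t => eta_max / Num.sqrt t.+1%:R.

Definition decay_cosine (eta_min eta_max : R) Tw T : nat -> R :=
  fun t => eta_min + (eta_max - eta_min) / 2 *
    (1 + cos ((t - Tw)%:R / (T - Tw)%:R * pi)).

Definition decay_polynomial (eta_min eta_max p : R) Tw T : nat -> R :=
  fun t => eta_min + (eta_max - eta_min) *
    (1 - (t - Tw)%:R / (T - Tw)%:R) `^ p.

Definition learning_rate (warm decay : nat -> R) Tw : nat -> R :=
  fun t => if (t < Tw)%N then warm t else decay t.

End Schedules.

(* Main.v *)
(* Write x_{t+1} = R(-eta_t (grad f + e_t)) where e_t is the minibatch error. It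
   has mean 0 given the past and mean square at most sigma^2 / b_t, so retraction
   smoothness gives
     E f(x_{t+1}) <= E f(x_t) - eta_t (1 - Lr eta_t / 2) E |grad f(x_t)|^2
                     + Lr sigma^2 eta_t^2 / (2 b_t).
   All learning rates are at most eta_max < 2 / Lr and both batch schedules make
   sum 1 / b_t converge, so telescoping bounds
   |G_T|^2 * sum_{Tw <= t < T} eta_t uniformly in T; it remains to bound this sum
   from below for each decay. No integrability is at stake: x_t is a function of
   the finitely many samples drawn before t, and all expectations are finite sums
   over these histories. *)

Require Import Defs.
From mathcomp Require Import measurable_realfun ring lra zify.

Set Implicit Arguments.
Unset Strict Implicit.
Unset Printing Implicit Defensive.

Local Open Scope classical_set_scope.
Local Open Scope ring_scope.

(** * Elementary bounds on finite sums *)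

Section SeriesBounds.
Context {R : realType}.
Implicit Types (u : nat -> R).

Lemma sum_geometric_le (r : R) m : 0 <= r -> r < 1 ->
  \sum_(k < m) r ^+ k <= (1 - r)^-1.
Proof.
move=> r0 r1; have h : 0 < 1 - r by lra.
rewrite -[leRHS]mul1r ler_pdivlMr//.
have := subrX1 r m; have := exprn_ge0 m r0; lra.
Qed.

Lemma sum_blocks u K m : (0 < K)%N ->
  \sum_(t < m * K) u (t %/ K)%N = K%:R * \sum_(k < m) u k.
Proof.
move=> K0; elim: m => [|m IH]; first by rewrite !big_ord0 mulr0.
rewrite mulSn addnC big_split_ord/= IH big_ord_recr/= mulrDr; congr (_ + _).
under eq_bigr do rewrite divnMDl// divn_small// addn0.
by rewrite sumr_const card_ord mulr_natl.
Qed.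

(** Extending the range from [T] to [T * K] adds only nonnegative terms and leaves whole blocks of
    length [K], on which [t %/ K] is constant. *)
Lemma sum_divn_le u K T B : (0 < K)%N -> (forall k, 0 <= u k) ->
  (forall m, \sum_(k < m) u k <= B) ->
  \sum_(t < T) u (t %/ K)%N <= K%:R * B.
Proof.
move=> K0 u0 uB; apply: (@le_trans _ _ (\sum_(t < T * K) u (t %/ K)%N)).
  have TK : (T <= T * K)%N by rewrite leq_pmulr.
  rewrite (big_ord_widen _ (fun t => u (t %/ K)%N) TK) big_mkcond/=.
  by apply: ler_sum => i _; case: ifP.
by rewrite sum_blocks// ler_wpM2l.
Qed.

(* Cauchy condensation: the block 2^j <= k < 2^(j+1) contributes at most
   2^j (a 2^j)^-c, a geometric sequence of ratio 2^(1-c). *)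
Lemma sum_powR_bounded (a b0 c : R) : 0 < a -> 0 < b0 -> 1 < c ->
  exists B, forall m, \sum_(k < m) ((a * k%:R + b0) `^ c)^-1 <= B.
Proof.
move=> a0 b00 c1.
have c0 : 0 <= c by lra.
pose r : R := 2 * (2 `^ c)^-1.
have r0 : 0 <= r by rewrite mulr_ge0// invr_ge0 powR_ge0.
have r1 : r < 1.
  (* Writing [2 ^ c] as [2 * 2 ^ (c - 1)], the claim becomes [1 < 2 ^ (c - 1)], which is where
     [1 < c] enters. *)
  rewrite ltr_pdivrMr ?powR_gt0// mul1r -(@mulr_powRB1 _ 2 c) ?ltr_pMr//; last lra.
  have : 1 `^ (c - 1) < 2 `^ (c - 1) :> R.
    by apply: gt0_ltr_powR; rewrite ?nnegrE//; lra.
  by rewrite powR1.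
pose u (k : nat) : R := ((a * k%:R + b0) `^ c)^-1.
have u0 k : 0 <= u k by rewrite invr_ge0 powR_ge0.
have uN : {homo u : i j / (i <= j)%N >-> j <= i}.
  move=> i j ij; rewrite lef_pV2 ?posrE ?powR_gt0 ?ltr_wpDl ?mulr_ge0 ?(ltW a0)//.
  by rewrite ge0_ler_powR ?nnegrE ?addr_ge0 ?mulr_ge0 ?(ltW a0) ?(ltW b00)//
    lerD2r ler_pM2l// ler_nat.
have block j : \sum_(i < 2 ^ j) u (2 ^ j + i)%N <= (a `^ c)^-1 * r ^+ j.
  apply: (@le_trans _ _ (\sum_(i < 2 ^ j) u (2 ^ j)%N)).
    by apply: ler_sum => i _; apply: uN; rewrite leq_addr.
  rewrite sumr_const card_ord -mulr_natl /r exprMn mulrCA natrX.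
  rewrite ler_pM2l ?exprn_gt0// exprVn -invfM.
  have -> : a `^ c * 2 `^ c ^+ j = (a * 2 ^+ j) `^ c.
    rewrite powRM ?(ltW a0) ?exprn_ge0//; congr (_ * _).
    by rewrite -powR_mulrn ?powR_ge0// -powRrM mulrC powRrM powR_mulrn.
  have aj : 0 < a * 2 ^+ j by rewrite mulr_gt0 ?exprn_gt0.
  rewrite lef_pV2 ?posrE ?powR_gt0 ?natrX ?ltr_wpDl ?(ltW aj)//.
  by apply: ge0_ler_powR; rewrite ?nnegrE ?addr_ge0 ?(ltW aj) ?(ltW b00) ?lerDl ?(ltW b00).
have pow2 m : \sum_(k < 2 ^ m) u k <= u 0%N + (a `^ c)^-1 * \sum_(j < m) r ^+ j.
  elim: m => [|m IH]; first by rewrite big_ord0 mulr0 addr0 expn0 big_ord1.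
  rewrite expnS mul2n -addnn big_split_ord [X in _ <= _ + _ * X]big_ord_recr/=.
  rewrite mulrDr addrA.
  exact: (lerD IH (block m)).
exists (u 0%N + (a `^ c)^-1 * (1 - r)^-1) => m.
apply: (le_trans _ (le_trans (pow2 m) _)).
  rewrite (big_ord_widen _ u (ltnW (@ltn_expl 2 m isT))) big_mkcond/=.
  by apply: ler_sum => i _; case: ifP.
by rewrite lerD2l ler_wpM2l ?invr_ge0 ?powR_ge0// sum_geometric_le.
Qed.

(** The indices below [uphalf m] satisfy [2 * k <= m] and make up at least half of the range; the
    remaining terms are nonnegative and are dropped. *)
Lemma sum_ge_half u c m : 0 <= c ->
  (forall k, (k < m)%N -> 0 <= u k) ->
  (forall k, (k < m)%N -> (2 * k <= m)%N -> c <= u k) ->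
  c / 2 * m%:R <= \sum_(k < m) u k.
Proof.
move=> c0 u0 uc; pose h := uphalf m.
have hm : (h <= m)%N by rewrite /h; lia.
apply: (@le_trans _ _ (\sum_(k < h) c)).
  rewrite sumr_const card_ord -[leRHS]mulr_natr -mulrA ler_wpM2l//.
  rewrite -ler_pdivlMl ?invr_gt0// invrK -natrM ler_nat /h; lia.
rewrite (big_ord_widen m (fun=> c) hm) big_mkcond/=.
apply: ler_sum => i _; case: ifP => ih; last exact: u0.
by apply: uc => //; move: ih; rewrite /h; lia.
Qed.

End SeriesBounds.

(** * Batch-size sums, warm-up rates and decay rates *)

Section Schedules.
Context {R : realType}.
Implicit Types (b : nat -> nat) (warm : nat -> R).

Lemma sum_invr_batch_bounded l K K' Tw b warm : (0 < K)%N ->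
  exponential_warmup l K K' Tw b warm \/ polynomial_warmup K K' Tw b warm ->
  exists2 C : R, 0 <= C & forall T, \sum_(t < T) (b t)%:R^-1 <= C.
Proof.
move=> K0 H.
(* In both schedules the batch size depends on [t] only through [t %/ K], so summability over block
   indices is enough: a geometric series of ratio [gamma^-1] for (E), a series of exponent [c > 1]
   for (P). *)
suff [u [u0 [B uB] bu]] : exists u : nat -> R, [/\ forall k, 0 <= u k,
    exists B, forall m, \sum_(k < m) u k <= B &
    forall t, (b t)%:R^-1 = u (t %/ K)%N].
  have hB T : \sum_(t < T) (b t)%:R^-1 <= K%:R * B.
    by under eq_bigr do rewrite bu; apply: sum_divn_le.
  by exists (K%:R * B) => //; have := hB 0%N; rewrite big_ord0.
case: H => [[b0 [eta0 [gamma [delta [[b00 _] [g1 _ _] hb _]]]]]|].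
  have gV : gamma^-1 < 1 by rewrite invf_lt1; lra.
  exists (fun k => b0^-1 * gamma^-1 ^+ k); split.
  - by move=> k; rewrite mulr_ge0 ?exprn_ge0 ?invr_ge0//; lra.
  - exists (b0^-1 * (1 - gamma^-1)^-1) => m.
    rewrite -mulr_sumr ler_wpM2l ?invr_ge0 ?(ltW b00)//.
    by apply: sum_geometric_le; rewrite ?invr_ge0//; lra.
  - by move=> t; rewrite hb invfM exprVn.
move=> [b0 [eta0 [a [s [c [q [[b00 _ a0 _] [c1 _] hb _]]]]]]].
exists (fun k => ((a * k%:R + b0) `^ c)^-1); split.
- by move=> k; rewrite invr_ge0 powR_ge0.
- exact: sum_powR_bounded.
- by move=> t; rewrite hb.
Qed.

(** Monotonicity places the largest warm-up rate at the last step [Tw.-1], hence every warm-up rate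
    lies in [[0, eta_max]]. *)
Lemma warmup_gt0_homo l K K' Tw b warm :
  exponential_warmup l K K' Tw b warm \/ polynomial_warmup K K' Tw b warm ->
  (forall t, (t < Tw)%N -> 0 < warm t) /\
  (forall i j, (i <= j < Tw)%N -> warm i <= warm j).
Proof.
case=> [[b0 [eta0 [gamma [delta [[_ e0] [_ d1 _] _ hw]]]]]|].
  split=> [t tT|i j /andP[ij jT]]; first by rewrite hw// mulr_gt0// exprn_gt0//; lra.
  rewrite !hw//; last exact: leq_ltn_trans jT.
  by rewrite ler_pM2l// ler_weXn2l// ?(ltW d1)// leq_div2r.
move=> [b0 [eta0 [a [s [c [q [[_ e0 _ s0] [_ q1] _ hw]]]]]]].
have pos k : 0 < s * k%:R + eta0 by rewrite ltr_wpDl ?mulr_ge0 ?(ltW s0).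
split=> [t tT|i j /andP[ij jT]]; first by rewrite hw// powR_gt0.
rewrite !hw//; last exact: leq_ltn_trans jT.
apply: ge0_ler_powR; rewrite ?nnegrE ?(ltW (pos _))//; first lra.
by rewrite lerD2r ler_pM2l// ler_nat leq_div2r.
Qed.

Lemma decay_diminishing_itv (eta_max : R) t : 0 <= eta_max ->
  0 <= decay_diminishing eta_max t <= eta_max.
Proof.
move=> e0; rewrite /decay_diminishing divr_ge0 ?sqrtr_ge0//=.
by rewrite ler_pdivrMr ?sqrtr_gt0// ler_peMr// -[leLHS]sqrtr1 ler_wsqrtr// ler1n.
Qed.

(** The sum is compared termwise with a telescoping one: the increment of the square root from
    [t + 1] to [t + 2] is at most the inverse square root of [t + 1]. *)
Lemma sum_decay_diminishing_ge (eta_max : R) Tw T : 0 <= eta_max -> (Tw <= T)%N ->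
  eta_max * (Num.sqrt T.+1%:R - Num.sqrt Tw.+1%:R) <=
  \sum_(Tw <= t < T) decay_diminishing eta_max t.
Proof.
move=> e0 TwT; rewrite -(@telescope_sumr _ Tw T (fun t => Num.sqrt t.+1%:R))//.
rewrite mulr_sumr; apply: ler_sum => t _; rewrite ler_wpM2l//.
have s0 : 0 < Num.sqrt t.+1%:R :> R by rewrite sqrtr_gt0.
have s1 : Num.sqrt t.+1%:R <= Num.sqrt t.+2%:R :> R by rewrite ler_wsqrtr// ler_nat.
rewrite -[leRHS]mul1r ler_pdivlMr//.
have h1 := @sqr_sqrtr R t.+1%:R (ler0n _ _).
have h2 := @sqr_sqrtr R t.+2%:R (ler0n _ _).
have : t.+2%:R = t.+1%:R + 1 :> R by rewrite natr1.
nra.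
Qed.

(* Both annealed schedules interpolate between eta_min and eta_max with a
   weight in [0, 1] that stays away from 0 in the first half of the decay. *)
Lemma sum_interpolation_ge (eta_min eta_max c : R) (w : nat -> R) Tw T :
  0 <= eta_min <= eta_max -> 0 <= c -> (Tw <= T)%N ->
  (forall k, (k < T - Tw)%N -> 0 <= w k <= 1) ->
  (forall k, (k < T - Tw)%N -> (2 * k <= T - Tw)%N -> c <= w k) ->
  eta_max * (c / 2) * (T%:R - Tw%:R) <=
  \sum_(Tw <= t < T) (eta_min + (eta_max - eta_min) * w (t - Tw)%N).
Proof.
move=> /andP[m0 mM] c0 TwT w01 wc.
(* The interpolated rate exceeds [eta_max * w k] by [eta_min * (1 - w k)], which is nonnegative. The
   bound therefore does not degrade when [eta_min = 0]. *)
apply: (@le_trans _ _ (\sum_(k < T - Tw) eta_max * w k)).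
  rewrite -mulr_sumr -mulrA -natrB// ler_wpM2l ?(le_trans m0)//.
  by apply: sum_ge_half => // k /w01/andP[].
rewrite [leRHS](_ : _ =
    \sum_(k < T - Tw) (eta_min + (eta_max - eta_min) * w k)); last first.
  rewrite -{1}(add0n Tw) big_addn big_mkord.
  by apply: eq_bigr => k _; rewrite addnK.
apply: ler_sum => k _; have /andP[] := w01 k (ltn_ord k); nra.
Qed.

Lemma interpolation_itv (m M w : R) : 0 <= m <= M -> 0 <= w <= 1 ->
  0 <= m + (M - m) * w <= M.
Proof. move=> /andP[? ?] /andP[? ?]; apply/andP; split; nra. Qed.

(** In both weights [m] stands for the length [T - Tw] of the decay part and [k] for the offset
    [t - Tw]. *)
Definition cosine_weight m (k : nat) : R := (1 + cos (k%:R / m%:R * pi)) / 2.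

Definition polynomial_weight (p : R) m (k : nat) : R := (1 - k%:R / m%:R) `^ p.

Lemma cosine_weight_itv m k : 0 <= cosine_weight m k <= 1.
Proof.
rewrite /cosine_weight; set x := _ * pi.
by have := cos_geN1 x; have := cos_le1 x; move=> ? ?; apply/andP; split; lra.
Qed.

(** In the first half of the decay the angle is at most [pi / 2], so its cosine is nonnegative. *)
Lemma cosine_weight_ge m k : (0 < m)%N -> (2 * k <= m)%N ->
  1 / 2 <= cosine_weight m k.
Proof.
move=> m0 km; rewrite /cosine_weight ler_pM2r ?invr_gt0// lerDl.
apply: cos_ge0_pihalf; have pi0 := pi_gt0 R.
have mR : (0 : R) < m%:R by rewrite ltr0n.
have h : k%:R / m%:R <= 2^-1 :> R.
  by rewrite ler_pdivrMr// ler_pdivlMl// -natrM ler_nat.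
have h' : 0 <= k%:R / m%:R :> R by rewrite divr_ge0.
apply/andP; split; nra.
Qed.

Lemma decay_cosineE (eta_min eta_max : R) Tw T t :
  decay_cosine eta_min eta_max Tw T t =
  eta_min + (eta_max - eta_min) * cosine_weight (T - Tw) (t - Tw).
Proof. by rewrite /decay_cosine /cosine_weight; lra. Qed.

Lemma polynomial_weight_itv p m k : 0 < p -> (k < m)%N ->
  0 <= polynomial_weight p m k <= 1.
Proof.
move=> p0 km; have m0 : (0 : R) < m%:R by rewrite ltr0n; lia.
have h : k%:R / m%:R <= 1 :> R by rewrite ler_pdivrMr// mul1r ler_nat ltnW.
have h' : 0 <= k%:R / m%:R :> R by rewrite divr_ge0.
have : (1 - k%:R / m%:R) `^ p <= 1 `^ p :> R.
  by apply: ge0_ler_powR; rewrite ?nnegrE; lra.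
by rewrite powR1 powR_ge0.
Qed.

(** In the first half of the decay the base is at least [1 / 2], and the power with exponent [p > 0]
    is monotone. *)
Lemma polynomial_weight_ge p m k : 0 < p -> (k < m)%N -> (2 * k <= m)%N ->
  2^-1 `^ p <= polynomial_weight p m k.
Proof.
move=> p0 km k2m.
have m0 : (0 : R) < m%:R by rewrite ltr0n; lia.
have h : k%:R / m%:R <= 2^-1 :> R.
  by rewrite ler_pdivrMr// ler_pdivlMl// -natrM ler_nat.
by apply: ge0_ler_powR; rewrite ?nnegrE; lra.
Qed.

End Schedules.

(** * The law of one batch of independent samples *)

Section ProductLaw.
Context {R : realType} {J : finType} {B : nat} (Pi : J -> R).
Hypothesis hPi : is_distr Pi.

Definition prod_weight (z : {ffun 'I_B -> J}) : R := \prod_i Pi (z i).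

Lemma prod_weight_ge0 z : 0 <= prod_weight z.
Proof. by apply: prodr_ge0 => i _; apply: hPi.1. Qed.

Lemma sum_prod_weight : \sum_z prod_weight z = 1.
Proof.
by rewrite -(bigA_distr_bigA (fun=> Pi)) big1// => i _; rewrite hPi.2.
Qed.

(** Two distinct coordinates are independent with law [Pi]; this is what makes cross terms vanish in
    the variance of a batch mean. *)
Lemma sum_prod_weight2 (h : J -> J -> R) i i' : i != i' ->
  \sum_z prod_weight z * h (z i) (z i') =
  \sum_a \sum_a' Pi a * Pi a' * h a a'.
Proof.
move=> ii'.
(* The constraints [z i = a] and [z i' = a'] become 0/1 factors attached to single coordinates, so
   that the sum over [z] factors into a product of sums over [J]. *)
pose F a a' k j : R := Pi j * ((k == i) ==> (j == a))%:R * ((k == i') ==> (j == a'))%:R.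
have hF a a' : \prod_k \sum_j F a a' k j = Pi a * Pi a'.
  rewrite (bigD1 i)//= (bigD1 i')//= 1?eq_sym//.
  rewrite [X in _ * (_ * X)]big1 ?mulr1 => [|k /andP[/negbTE ki /negbTE ki']]; last first.
    by rewrite -[RHS]hPi.2; apply: eq_bigr => j _; rewrite /F ki ki' !mulr1.
  congr (_ * _).
    rewrite (bigD1 a)//= big1 => [|j /negbTE ja].
      by rewrite /F !eqxx/= (negbTE ii') !mulr1 addr0.
    by rewrite /F eqxx ja/= mulr0 mul0r.
  rewrite (bigD1 a')//= big1 => [|j /negbTE ja].
    by rewrite /F !eqxx/= eq_sym (negbTE ii') !mulr1 addr0.
  by rewrite /F eqxx ja/= mulr0.
under [RHS]eq_bigr => a _ do under eq_bigr => a' _ do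
  rewrite -hF bigA_distr_bigA mulr_suml.
under [RHS]eq_bigr do rewrite exchange_big/=.
rewrite [RHS]exchange_big/=; apply: eq_bigr => z _.
have hz a a' : \prod_k F a a' k (z k) = prod_weight z * (z i == a)%:R * (z i' == a')%:R.
  rewrite !big_split/=; congr (_ * _ * _).
    rewrite (bigD1 i)//= eqxx big1 ?mulr1// => k /negbTE ->//.
  rewrite (bigD1 i')//= eqxx big1 ?mulr1// => k /negbTE ->//.
under [RHS]eq_bigr => a _ do under eq_bigr => a' _ do rewrite hz.
rewrite (bigD1 (z i))//= [X in _ + X]big1 => [|a /negbTE]; last first.
  by rewrite eq_sym => az; rewrite big1// => a' _; rewrite az mulr0 !mul0r.
rewrite addr0 (bigD1 (z i'))//= big1 => [|a /negbTE].
  by rewrite !eqxx !mulr1 addr0.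
by rewrite eq_sym => az; rewrite az mulr0 !mul0r.
Qed.

Lemma sum_prod_weight1 (h : J -> R) i :
  \sum_z prod_weight z * h (z i) = \sum_a Pi a * h a.
Proof.
pose F a k j : R := Pi j * ((k == i) ==> (j == a))%:R.
have hF a : \prod_k \sum_j F a k j = Pi a.
  rewrite (bigD1 i)//= [X in _ * X]big1 ?mulr1 => [|k /negbTE ki]; last first.
    by rewrite -[RHS]hPi.2; apply: eq_bigr => j _; rewrite /F ki mulr1.
  rewrite (bigD1 a)//= big1 => [|j /negbTE ja].
    by rewrite /F !eqxx/= !mulr1 addr0.
  by rewrite /F eqxx ja/= mulr0.
under [RHS]eq_bigr => a _ do rewrite -hF bigA_distr_bigA mulr_suml.
rewrite [RHS]exchange_big/=; apply: eq_bigr => z _.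
have hz a : \prod_k F a k (z k) = prod_weight z * (z i == a)%:R.
  rewrite !big_split/=; congr (_ * _).
  by rewrite (bigD1 i)//= eqxx big1 ?mulr1// => k /negbTE ->.
rewrite (bigD1 (z i))//= [X in _ + X]big1 => [|a /negbTE].
  by rewrite hz eqxx mulr1 addr0.
by rewrite eq_sym => az; rewrite hz az mulr0 mul0r.
Qed.

End ProductLaw.

(** * Finite histories of samples and their weights *)

Section HistoryWeight.
Context {R : realType} {J : finType} (Pi : J -> R) (b : nat -> nat).

(** A history records all batches drawn before time [t]. The recursive product allows the batch size
    to vary with time and remains a finite type. *)
Fixpoint history_type (t : nat) : finType :=
  if t is s.+1 then (history_type s * {ffun 'I_(b s) -> J})%type else unit.

Fixpoint history_weight (t : nat) : history_type t -> R :=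
  match t return history_type t -> R with
  | 0 => fun=> 1
  | s.+1 => fun h => history_weight h.1 * prod_weight Pi h.2
  end.

Context {Omega : Type} (xi : forall t : nat, 'I_(b t) -> Omega -> J).

Fixpoint history (t : nat) : Omega -> history_type t :=
  match t return Omega -> history_type t with
  | 0 => fun=> tt
  | s.+1 => fun w => (history s w, [ffun i => xi i w])
  end.

Hypothesis hPi : is_distr Pi.

Lemma history_weight_ge0 t (h : history_type t) : 0 <= history_weight h.
Proof. by elim: t h => [|t IH] h //=; rewrite mulr_ge0 ?prod_weight_ge0. Qed.

(** This is the tower property: the inner sum is the conditional expectation over the batch of time
    [t] given the past. *)
Lemma sum_history_weightS t (F : history_type t -> {ffun 'I_(b t) -> J} -> R) :
  \sum_(h : history_type t.+1) history_weight h * F h.1 h.2 =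
  \sum_h history_weight h * \sum_z prod_weight Pi z * F h z.
Proof.
under [RHS]eq_bigr do rewrite mulr_sumr.
by rewrite pair_bigA/=; apply: eq_bigr => h _; rewrite mulrA.
Qed.

Lemma sum_history_weight t : \sum_(h : history_type t) history_weight h = 1.
Proof.
elim: t => [|t IH].
  by rewrite (bigD1 tt)//= big1 ?addr0// => -[].
under eq_bigr do rewrite -[history_weight _]mulr1.
rewrite (sum_history_weightS (fun _ _ => 1)) -[RHS]IH; apply: eq_bigr => h _.
by under eq_bigr do rewrite mulr1; rewrite sum_prod_weight// mulr1.
Qed.

End HistoryWeight.

Arguments history_type : clear implicits.

(** * The law of the histories under [P] *)

Section History.
Context {R : realType} {d : measure_display} {Omega : measurableType d}
  (P : probability Omega R).
Context {J : finType} (Pi : J -> R) (b : nat -> nat)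
  (xi : forall t : nat, 'I_(b t) -> Omega -> J).
Hypothesis hxi : iid P Pi (fun k : {t : nat & 'I_(b t)} => @xi (tag k) (tagged k)).

Let event (k : {t : nat & 'I_(b t)}) (A : set J) : set Omega :=
  @xi (tag k) (tagged k) @^-1` A.

Lemma history_preimage_recr t (h : history_type J b t) (z : {ffun 'I_(b t) -> J}) :
  history xi t.+1 @^-1` [set (h, z)] =
  history xi t @^-1` [set h] `&` \bigcap_(i in [set: 'I_(b t)]) (xi i @^-1` [set z i]).
Proof.
apply/seteqP; split=> w/=.
  by case=> -> <-; split=> // i _ /=; rewrite ffunE.
by case=> -> hz; congr (_, _); apply/ffunP => i; rewrite ffunE; apply: hz.
Qed.

Lemma measurable_history t (h : history_type J b t) : measurable (history xi t @^-1` [set h]).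
Proof.
elim: t h => [|t IH] => [[]|[h z]].
  rewrite (_ : _ @^-1` _ = setT)//.
  by apply/seteqP; split.
rewrite history_preimage_recr; apply: measurableI => //.
apply: fin_bigcap_measurable => // i _.
exact: (iid_measurable hxi (Tagged (fun t => 'I_(b t)) i)).
Qed.

(* The samples indexed by s, all at times >= t, are carried along in order to
   make the induction on t go through. *)
Lemma history_law_gen t (h : history_type J b t) (s : seq {t : nat & 'I_(b t)})
    (A : {t : nat & 'I_(b t)} -> set J) :
  uniq s -> {in s, forall k, (t <= tag k)%N} ->
  P (history xi t @^-1` [set h] `&` \bigcap_(k in [set` s]) event k (A k)) =
  ((history_weight Pi h)%:E * \prod_(k <- s) P (event k (A k)))%E.
Proof.
elim: t h s A => [|t IH] => [[]|[h z]] s A us ts.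
  rewrite (_ : _ @^-1` _ = setT); last by apply/seteqP; split.
  by rewrite setTI mul1e (iid_independent hxi).
pose tg (i : 'I_(b t)) := Tagged (fun t => 'I_(b t)) i.
pose s' := [seq tg i | i <- enum 'I_(b t)] ++ s.
(* [A'] pins the samples of time [t] to the values of [z] and agrees with [A] on [s], whose tags
   exceed [t]. Quantifying over [i] avoids casting [tagged k] along [tag k = t]. *)
pose A' (k : {t : nat & 'I_(b t)}) : set J :=
  if tag k == t then [set j | exists2 i, k = tg i & j = z i] else A k.
have A'tg i : A' (tg i) = [set z i].
  rewrite /A' /= eqxx; apply/seteqP; split=> j /=; last by move=> ->; exists i.
  by case=> i' /eqP; rewrite eq_Tagged/= => /eqP ->.
have A's k : k \in s -> A' k = A k.
  by move=> /ts tk; rewrite /A' gtn_eqF.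
have := IH h s' A'.
rewrite history_preimage_recr -setIA => IH'.
have -> : \bigcap_(i in [set: 'I_(b t)]) (xi i @^-1` [set z i]) `&`
    \bigcap_(k in [set` s]) event k (A k) = \bigcap_(k in [set` s']) event k (A' k).
  apply/seteqP; split=> w /=.
    move=> [hz hs] k /=; rewrite mem_cat => /orP[/mapP[i _ ->]|ks].
      by rewrite /event A'tg; apply: hz.
    by rewrite A's//; apply: hs.
  move=> hs; split=> [i _|k /= ks].
    have := hs (tg i); rewrite /event A'tg; apply.
    by rewrite /= mem_cat map_f// mem_enum.
  by rewrite -A's//; apply: hs; rewrite /= mem_cat ks orbT.
rewrite {}IH'; first last.
- move=> k; rewrite mem_cat => /orP[/mapP[i _ ->]//|/ts/ltnW//].
- rewrite cat_uniq us andbT map_inj_uniq ?enum_uniq/=; last first.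
    by move=> i i' /eqP; rewrite eq_Tagged/= => /eqP.
  apply/hasPn => k /ts tk; apply/mapP => -[i _ ki].
  by move: tk; rewrite ki ltnn.
rewrite big_cat/= big_map big_enum/= EFinM -muleA; congr (_ * (_ * _))%E.
  rewrite /prod_weight -prodEFin; apply: eq_bigr => i _.
  by rewrite A'tg (iid_law hxi).
by rewrite !big_seq; apply: eq_bigr => k /A's ->.
Qed.

Lemma history_law t (h : history_type J b t) :
  P (history xi t @^-1` [set h]) = (history_weight Pi h)%:E.
Proof.
have := @history_law_gen t h [::] (fun=> setT) isT.
rewrite big_nil mule1 => <-//; congr (P _).
by apply/seteqP; split=> [w ? |w []]//; split.
Qed.

(** The integrand is a finite combination of indicators of the events fixing the history.
    Nonnegativity of [phi] allows integration term by term without any integrability condition. *)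
Lemma expectation_history t (phi : history_type J b t -> R) :
  (forall h, 0 <= phi h) ->
  ('E_P[fun w => phi (history xi t w)])%E = (\sum_h history_weight Pi h * phi h)%:E.
Proof.
move=> phi0; rewrite unlock.
have -> : (fun w => (phi (history xi t w))%:E) =
  (fun w => \sum_h (phi h)%:E * (\1_(history xi t @^-1` [set h]) w)%:E)%E.
  apply/funext => w; rewrite (bigD1 (history xi t w))//= big1 => [|h hw].
    by rewrite adde0 indicE mem_set// mule1.
  by rewrite indicE memNset ?mule0// => /= E; move: hw; rewrite -E eqxx.
rewrite ge0_integral_sum//; first last.
- by move=> h w _; rewrite mule_ge0 ?lee_fin.
- move=> h; apply/measurable_EFinP; apply: measurable_funM => //.
  by apply: measurable_indic; apply: measurable_history.
rewrite -sumEFin; apply: eq_bigr => h _.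
rewrite ge0_integralZl_EFin//; last first.
  by apply/measurable_EFinP; apply: measurable_indic; apply: measurable_history.
rewrite integral_indic//; last exact: measurable_history.
rewrite setIT; transitivity ((phi h)%:E * (history_weight Pi h)%:E)%E.
  by congr (_ * _)%E; apply: history_law.
by rewrite -EFinM mulrC.
Qed.

End History.

(** * Inner product identities on a tangent space *)

Section InnerProduct.
Context {R : realType} {n : nat} {M : smoothManifold R n} (g : riemannianMetric M).
Context {x : M}.
Implicit Types u v w : tangent x.

Lemma innerDr u v w : inner g u (v + w : tangent x) = inner g u v + inner g u w.
Proof. by rewrite inner_sym innerDl !(inner_sym g u). Qed.

Lemma innerZr a u v : inner g u (a *: v : tangent x) = a * inner g u v.
Proof. by rewrite inner_sym innerZl inner_sym. Qed.

Lemma inner_sumr (I : finType) u (F : I -> tangent x) :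
  inner g u (\sum_i F i : tangent x) = \sum_i inner g u (F i).
Proof. by rewrite inner_sym inner_suml; apply: eq_bigr => i _; rewrite inner_sym. Qed.

Lemma rnorm_sqr v : rnorm g v ^+ 2 = inner g v v.
Proof.
rewrite /rnorm sqr_sqrtr//; have [->|v0] := eqVneq v (0 : tangent x).
  by rewrite inner0l.
exact/ltW/inner_gt0.
Qed.

End InnerProduct.

Lemma centered_mean0 {R : realType} {V : lmodType R} {J : finType} (Pi : J -> R)
    (Y : J -> V) (G : V) : is_distr Pi -> \sum_j Pi j *: Y j = G ->
  \sum_j Pi j *: (Y j - G) = 0.
Proof.
move=> hPi <-; under eq_bigr do rewrite scalerBr.
by rewrite sumrB -scaler_suml hPi.2 scale1r subrr.
Qed.

(** * First and second moments of a batch mean *)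

Section MinibatchMoments.
Context {R : realType} {n : nat} {M : smoothManifold R n} (g : riemannianMetric M).
Context {x : M} {J : finType} (Pi : J -> R) (B : nat) (Y : J -> tangent x).
Hypothesis hPi : is_distr Pi.
Hypothesis Y0 : \sum_j Pi j *: Y j = 0 :> tangent x.

Definition batch_mean (Y : J -> tangent x) (z : {ffun 'I_B -> J}) : tangent x :=
  B%:R^-1 *: \sum_i Y (z i).

Lemma batch_mean_center (G : tangent x) (z : {ffun 'I_B -> J}) : (0 < B)%N ->
  batch_mean Y z = G + batch_mean (fun j => Y j - G : tangent x) z :> tangent x.
Proof.
move=> B0; rewrite /batch_mean big_split/= sumr_const card_ord scalerDr.
rewrite -[X in _ + (_ + _ *: X)]scaler_nat scalerA mulVf ?pnatr_eq0 -?lt0n//.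
by rewrite scale1r addrC subrK.
Qed.

Lemma batch_mean_finfun (F : 'I_B -> J) :
  batch_mean Y [ffun i => F i] = B%:R^-1 *: \sum_i Y (F i) :> tangent x.
Proof. by congr (_ *: _); apply: eq_bigr => i _; rewrite ffunE. Qed.

Lemma batch_mean_inner_expectation (u : tangent x) :
  \sum_z prod_weight Pi z * inner g u (batch_mean Y z) = 0.
Proof.
under eq_bigr do rewrite innerZr inner_sumr mulrCA mulr_sumr.
rewrite -mulr_sumr exchange_big/= big1 ?mulr0// => i _.
rewrite (sum_prod_weight1 hPi (fun j => inner g u (Y j)) i).
under eq_bigr do rewrite -innerZr.
by rewrite -inner_sumr Y0 inner_sym inner0l.
Qed.

(** Expanding the square, the off-diagonal terms vanish by independence and [Y0]; the [B] equal
    diagonal terms, divided by the square of [B], leave the factor [B%:R^-1]. *)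
Lemma batch_mean_sqr_expectation : (0 < B)%N ->
  \sum_z prod_weight Pi z * rnorm g (batch_mean Y z) ^+ 2 =
  B%:R^-1 * \sum_j Pi j * rnorm g (Y j) ^+ 2.
Proof.
move=> B0.
transitivity (B%:R^-1 * B%:R^-1 * \sum_(i < B) \sum_(i' < B)
    \sum_z prod_weight Pi z * inner g (Y (z i)) (Y (z i'))).
  under [in RHS]eq_bigr do rewrite exchange_big/=.
  rewrite [in RHS]exchange_big/= mulr_sumr; apply: eq_bigr => z _.
  rewrite rnorm_sqr innerZl innerZr inner_suml.
  have -> : \sum_i inner g (Y (z i)) (\sum_i' Y (z i') : tangent x) =
      \sum_i \sum_i' inner g (Y (z i)) (Y (z i')).
    by apply: eq_bigr => i _; rewrite inner_sumr.
  rewrite mulrCA [X in _ * X]mulrCA mulrA; congr (_ * _).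
  by rewrite mulr_sumr; apply: eq_bigr => i _; rewrite mulr_sumr.
have row i : \sum_(i' < B) \sum_z prod_weight Pi z * inner g (Y (z i)) (Y (z i')) =
    \sum_j Pi j * inner g (Y j) (Y j).
  rewrite (bigD1 i)//= [X in _ + X]big1 ?addr0.
    exact: (sum_prod_weight1 hPi (fun j => inner g (Y j) (Y j)) i).
  move=> i' i'i; rewrite eq_sym in i'i.
  rewrite (sum_prod_weight2 hPi (fun j j' => inner g (Y j) (Y j')) i'i).
  rewrite big1// => a _.
  under eq_bigr do rewrite -mulrA -innerZr.
  by rewrite -mulr_sumr -inner_sumr Y0 inner_sym inner0l mulr0.
under eq_bigr do rewrite row.
rewrite sumr_const card_ord -[X in _ * X]mulr_natl mulrA.
rewrite mulfVK ?pnatr_eq0 -?lt0n//.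
by congr (_ * _); apply: eq_bigr => j _; rewrite rnorm_sqr.
Qed.

End MinibatchMoments.

(** * Expected descent along the iterates *)

Section Descent.
Context {R : realType} {n : nat} {M : smoothManifold R n} (g : riemannianMetric M).
Context (Retr : forall x : M, tangent x -> M).
Context {N : nat} (fs : 'I_N -> M -> R) (Lr sigma : R) (Pi : 'I_N -> R).
Hypothesis hLr : 0 < Lr.
Hypothesis hsmooth : retraction_smooth g Retr (average fs) Lr.
Hypothesis hPi : is_distr Pi.
Hypothesis hunbiased : unbiased g fs Pi.
Hypothesis hvariance : bounded_variance g fs Pi sigma.

Let f := average fs.

Lemma grad_error_mean0 (x : M) :
  \sum_j Pi j *: (grad g (fs j) x - grad g f x : tangent x) = 0 :> tangent x.
Proof. exact: centered_mean0 hPi (hunbiased x). Qed.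

Lemma one_step_descent (x : M) (eta : R) B : (0 < B)%N ->
  \sum_(z : {ffun 'I_B -> 'I_N}) prod_weight Pi z *
    f (Retr (- eta *: batch_mean (fun j => grad g (fs j) x) z : tangent x)) <=
  f x - eta * (1 - Lr * eta / 2) * rnorm g (grad g f x) ^+ 2 +
    Lr * sigma ^+ 2 * eta ^+ 2 / 2 * B%:R^-1.
Proof.
move=> B0.
pose G : tangent x := grad g f x.
pose Y j : tangent x := grad g (fs j) x - G.
(* Retraction smoothness is expanded with the batch gradient written as [G] plus the mean of the
   errors [Y]. The cross term receives [- eta] from the linear part and [Lr * eta ^+ 2] from the
   quadratic part; it averages to zero. *)
apply: (@le_trans _ _ (\sum_(z : {ffun 'I_B -> 'I_N}) (
    (f x - eta * (1 - Lr * eta / 2) * rnorm g G ^+ 2) * prod_weight Pi z +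
    (Lr * eta ^+ 2 - eta) * (prod_weight Pi z * inner g G (batch_mean Y z)) +
    Lr * eta ^+ 2 / 2 * (prod_weight Pi z * rnorm g (batch_mean Y z) ^+ 2)))).
  apply: ler_sum => z _.
  apply: (le_trans (ler_wpM2l (prod_weight_ge0 hPi z) (hsmooth _))).
  rewrite (batch_mean_center _ G)// -/f -/G -/Y !rnorm_sqr.
  rewrite !(innerZl, innerZr, innerDl, innerDr) (inner_sym g _ G).
  rewrite le_eqVlt; apply/predU1P; left; field.
  by rewrite pnatr_eq0 -lt0n.
rewrite !big_split/= -!mulr_sumr sum_prod_weight// mulr1.
rewrite (batch_mean_inner_expectation g B hPi (grad_error_mean0 x)) mulr0 addr0.
rewrite (batch_mean_sqr_expectation g hPi (grad_error_mean0 x))// lerD2l.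
rewrite [leRHS](_ : _ = Lr * eta ^+ 2 / 2 * (B%:R^-1 * sigma ^+ 2)); last by field;
  rewrite pnatr_eq0 -lt0n.
rewrite ler_wpM2l//; last by rewrite ler_wpM2l ?invr_ge0.
by apply: divr_ge0 => //; apply: mulr_ge0; rewrite ?sqr_ge0 ?(ltW hLr).
Qed.

Context (b : nat -> nat) (eta : nat -> R) (x0 : M).

(** The iterate is expressed on the finite type of histories, without reference to [Omega], so that
    descent can be proved by finite sums alone. *)
Fixpoint history_rsgd (t : nat) : history_type 'I_N b t -> M :=
  match t return history_type 'I_N b t -> M with
  | 0 => fun=> x0
  | s.+1 => fun h =>
      let x := history_rsgd h.1 in
      Retr (- eta s *: batch_mean (fun j => grad g (fs j) x) h.2 : tangent x)
  end.

Lemma rsgd_history (Omega : Type) (xi : forall t, 'I_(b t) -> Omega -> 'I_N) t w :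
  rsgd g Retr fs xi eta x0 t w = history_rsgd (history xi t w).
Proof.
have gradE s x : minibatch_grad g fs xi s w x =
    batch_mean (fun j => grad g (fs j) x) [ffun i => @xi s i w].
  by rewrite batch_mean_finfun.
elim: t => [//|t IH].
by rewrite [RHS]/= -IH -gradE.
Qed.

Let expect t (phi : M -> R) : R :=
  \sum_h history_weight Pi h * phi (history_rsgd (t := t) h).

Lemma history_descent t : (0 < b t)%N ->
  expect t.+1 f + eta t * (1 - Lr * eta t / 2) *
    expect t (fun x => rnorm g (grad g f x) ^+ 2) <=
  expect t f + Lr * sigma ^+ 2 / 2 * (eta t ^+ 2 * (b t)%:R^-1).
Proof.
move=> bt0; rewrite -lerBrDr.
pose next (h : history_type 'I_N b t) (z : {ffun 'I_(b t) -> 'I_N}) : M :=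
  let x := history_rsgd h in
  Retr (- eta t *: batch_mean (fun j => grad g (fs j) x) z : tangent x).
rewrite [leLHS](sum_history_weightS Pi (fun h z => f (next h z))).
apply: (le_trans (ler_sum _ (fun h _ => ler_wpM2l (history_weight_ge0 hPi h)
  (one_step_descent (history_rsgd h) (eta t) bt0)))).
rewrite le_eqVlt; apply/predU1P; left.
under eq_bigr do rewrite mulrDr mulrBr.
rewrite big_split/= sumrB -mulr_suml sum_history_weight// mul1r mulr_sumr.
rewrite addrAC; congr (_ + _ - _); first by ring.
by apply: eq_bigr => h _; rewrite mulrCA.
Qed.

Lemma history_telescope T : (forall t, (0 < b t)%N) ->
  expect T f + \sum_(t < T) eta t * (1 - Lr * eta t / 2) *
    expect t (fun x => rnorm g (grad g f x) ^+ 2) <=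
  f x0 + Lr * sigma ^+ 2 / 2 * \sum_(t < T) (eta t ^+ 2 * (b t)%:R^-1).
Proof.
move=> b0; elim: T => [|T IH].
  rewrite !big_ord0 mulr0 !addr0 /expect (bigD1 tt)//= mul1r.
  by rewrite [X in _ + X]big1 ?addr0// => -[].
rewrite !big_ord_recr/= mulrDr.
have := history_descent (b0 T); lra.
Qed.

Context {d : measure_display} {Omega : measurableType d} (P : probability Omega R)
  (xi : forall t : nat, 'I_(b t) -> Omega -> 'I_N).
Hypothesis hxi : iid P Pi (fun k : {t : nat & 'I_(b t)} => @xi (tag k) (tagged k)).

Let S t : R :=
  fine ('E_P[fun w => (rnorm g (grad g f (rsgd g Retr fs xi eta x0 t w)) ^+ 2)%R])%E.

Lemma expectation_sqgrad t : S t = expect t (fun x => rnorm g (grad g f x) ^+ 2).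
Proof.
rewrite /S; have -> : (fun w => rnorm g (grad g f (rsgd g Retr fs xi eta x0 t w)) ^+ 2) =
    (fun w => rnorm g (grad g f (history_rsgd (history xi t w))) ^+ 2).
  by apply/funext => w; rewrite rsgd_history.
rewrite (@expectation_history _ _ _ _ _ _ _ _ hxi t
  (fun h => rnorm g (grad g f (history_rsgd h)) ^+ 2))// => h.
exact: sqr_ge0.
Qed.

Lemma expectation_sqgrad_ge0 t : 0 <= S t.
Proof.
rewrite expectation_sqgrad; apply: sumr_ge0 => h _.
by rewrite mulr_ge0 ?sqr_ge0// history_weight_ge0.
Qed.

Lemma min_sqgrad_ge0 T : 0 <= min_sqgrad g Retr fs P xi x0 eta T.
Proof.
rewrite /min_sqgrad; elim/big_ind: _ => [|x y x_ge0 y_ge0|t _].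
- exact: expectation_sqgrad_ge0.
- by rewrite le_min x_ge0.
- exact: expectation_sqgrad_ge0.
Qed.

Lemma min_sqgrad_le T t : (t < T)%N -> min_sqgrad g Retr fs P xi x0 eta T <= S t.
Proof. by move=> tT; exact: (bigmin_le _ (Ordinal tT)). Qed.

Lemma min_sqgrad_sum_le (eta_max m : R) Tw T : (forall t, (0 < b t)%N) ->
  (forall x, m <= f x) -> (Tw <= T)%N ->
  (forall t, (t < T)%N -> 0 <= eta t <= eta_max) -> eta_max < 2 / Lr ->
  min_sqgrad g Retr fs P xi x0 eta T *
    ((1 - Lr * eta_max / 2) * \sum_(Tw <= t < T) eta t) <=
  f x0 - m + Lr * sigma ^+ 2 / 2 * eta_max ^+ 2 * \sum_(t < T) (b t)%:R^-1.
Proof.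
move=> b0 fm TwT heta eta_lt.
have c0 : 0 < 1 - Lr * eta_max / 2.
  by move: eta_lt; rewrite ltr_pdivlMr//; lra.
(* The weights of the histories sum to 1, so the lower bound [m] of [f] passes to the
   expectation. *)
have mT : m <= expect T f.
  rewrite -[leLHS]mul1r -(sum_history_weight b hPi T) mulr_suml.
  by apply: ler_sum => h _; rewrite ler_wpM2l ?history_weight_ge0.
have S0 t : 0 <= expect t (fun x => rnorm g (grad g f x) ^+ 2).
  by rewrite -expectation_sqgrad expectation_sqgrad_ge0.
have c_le t : (t < T)%N -> 1 - Lr * eta_max / 2 <= 1 - Lr * eta t / 2.
  by move=> /heta/andP[_ ?]; rewrite lerD2l lerN2 ler_pM2r ?invr_gt0// ler_pM2l.
have hsum : \sum_(t < T) (eta t ^+ 2 * (b t)%:R^-1) <=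
    eta_max ^+ 2 * \sum_(t < T) (b t)%:R^-1.
  rewrite mulr_sumr; apply: ler_sum => t _; rewrite ler_wpM2r ?invr_ge0//.
  by have /andP[? ?] := heta t (ltn_ord t); rewrite lerXn2r ?nnegrE//; lra.
(* The warm-up terms are nonnegative and dropped. On the decay part each expectation is at least the
   minimum, and each factor [1 - Lr * eta t / 2] is at least its positive value at [eta_max]. *)
have hmin : min_sqgrad g Retr fs P xi x0 eta T *
    ((1 - Lr * eta_max / 2) * \sum_(Tw <= t < T) eta t) <=
    \sum_(t < T) eta t * (1 - Lr * eta t / 2) *
      expect t (fun x => rnorm g (grad g f x) ^+ 2).
  rewrite -(big_mkord xpredT (fun t => eta t * (1 - Lr * eta t / 2) *
      expect t (fun x => rnorm g (grad g f x) ^+ 2))) (big_cat_nat (leq0n Tw) TwT)/=.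
  rewrite -[leLHS]add0r; apply: lerD.
    rewrite big_nat; apply: sumr_ge0 => t /andP[_ tTw].
    have tT := leq_trans tTw TwT; have /andP[? _] := heta t tT.
    by rewrite !mulr_ge0//; have := c_le t tT; lra.
  rewrite !mulr_sumr !big_nat; apply: ler_sum => t /andP[_ tT].
  have /andP[e0 _] := heta t tT; rewrite mulrC; apply: ler_pM.
  - by rewrite mulr_ge0 ?(ltW c0).
  - exact: min_sqgrad_ge0.
  - by rewrite mulrC ler_wpM2l// c_le.
  - by rewrite -expectation_sqgrad min_sqgrad_le.
have := history_telescope T b0.
have : Lr * sigma ^+ 2 / 2 * \sum_(t < T) (eta t ^+ 2 * (b t)%:R^-1) <=
    Lr * sigma ^+ 2 / 2 * (eta_max ^+ 2 * \sum_(t < T) (b t)%:R^-1).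
  rewrite ler_wpM2l//.
  by apply: divr_ge0 => //; apply: mulr_ge0; rewrite ?sqr_ge0 ?(ltW hLr).
rewrite (mulrA (Lr * sigma ^+ 2 / 2)); lra.
Qed.

End Descent.

(** * Lower bound of the objective and the asymptotic rates *)

Lemma average_bounded_below {R : realType} {n : nat} {M : smoothManifold R n} {N : nat}
    (fs : 'I_N -> M -> R) :
  (forall j, bounded_below (fs j)) -> bounded_below (average fs).
Proof.
move=> /choice[m hm]; exists (N%:R^-1 * \sum_j m j) => x.
by rewrite ler_wpM2l ?invr_ge0//; apply: ler_sum => j _.
Qed.

Theorem theorem7
    (R : realType) (n : nat) (M : smoothManifold R n) (g : riemannianMetric M)
    (Retr : forall x : M, tangent x -> M) (hRetr : retraction Retr)
    (N : nat) (fs : 'I_N -> M -> R)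
    (hfs : forall j, smooth_function (fs j))
    (hfs_bounded : forall j, bounded_below (fs j))
    (Lr : R) (hLr : 0 < Lr)
    (hsmooth : retraction_smooth g Retr (average fs) Lr)
    (Pi : 'I_N -> R) (hPi : is_distr Pi)
    (hunbiased : unbiased g fs Pi)
    (sigma : R) (hsigma : 0 < sigma)
    (hvariance : bounded_variance g fs Pi sigma)
    (K' l lw K Tw : nat) (hK' : (0 < K')%N) (hl : (0 < l)%N) (hlw : (l <= lw)%N)
    (hK : K = (l * K')%N) (hTw : Tw = (lw * K')%N)
    (b : nat -> nat) (hb : forall t, (0 < b t)%N) (warm : nat -> R)
    (hschedule : exponential_warmup l K K' Tw b warm \/
                 polynomial_warmup K K' Tw b warm)
    (eta_max eta_min p : R) (heta_max : eta_max = warm Tw.-1)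
    (heta_max_lt : eta_max < 2 / Lr)
    (heta_min : 0 <= eta_min <= eta_max) (hp : 0 < p)
    (d : measure_display) (Omega : measurableType d) (P : probability Omega R)
    (xi : forall t : nat, 'I_(b t) -> Omega -> 'I_N)
    (hxi : iid P Pi (fun k : {t : nat & 'I_(b t)} => xi (tag k) (tagged k)))
    (x0 : M) :
  let G (decay : nat -> nat -> R) (T : nat) : R :=
    min_sqgrad g Retr fs P xi x0 (learning_rate warm (decay T) Tw) T in
  G (fun _ => decay_diminishing eta_max) =O_\oo
    (fun T => (Num.sqrt T.+1%:R - Num.sqrt Tw.+1%:R)^-1 : R) /\
  [/\ G (fun _ => decay_constant eta_max) =O_\oo
        (fun T => (T%:R - Tw%:R)^-1 : R),
      G (decay_cosine eta_min eta_max Tw) =O_\oo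
        (fun T => (T%:R - Tw%:R)^-1 : R) &
      G (decay_polynomial eta_min eta_max p Tw) =O_\oo
        (fun T => (T%:R - Tw%:R)^-1 : R)].
Proof.
have K0 : (0 < K)%N by rewrite hK muln_gt0 hl.
have Tw0 : (0 < Tw)%N by rewrite hTw muln_gt0 hK' (leq_trans hl).
have [C C0 sumbC] := sum_invr_batch_bounded K0 hschedule.
have [warm_gt0 warm_homo] := warmup_gt0_homo hschedule.
have eta_max_gt0 : 0 < eta_max by rewrite heta_max warm_gt0// prednK.
have [m fm] := average_bounded_below hfs_bounded.
(* All four decays reduce to two facts: the rates stay in [[0, eta_max]], and their sum over the
   decay part is at least [kappa * D T]. *)
have bound (decay : nat -> nat -> R) (D : nat -> R) (kappa : R) : 0 < kappa ->
    (forall T, (Tw < T)%N -> 0 < D T) ->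
    (forall T t, (Tw <= t < T)%N -> 0 <= decay T t <= eta_max) ->
    (forall T, (Tw < T)%N -> kappa * D T <= \sum_(Tw <= t < T) decay T t) ->
    (fun T => min_sqgrad g Retr fs P xi x0 (learning_rate warm (decay T) Tw) T) =O_\oo
      (fun T => (D T)^-1 : R).
  move=> kappa0 D0 decay_itv decay_sum.
  pose c : R := 1 - Lr * eta_max / 2.
  have c0 : 0 < c.
    by rewrite /c; move: heta_max_lt; rewrite ltr_pdivlMr//; lra.
  (* [A] bounds the right-hand side of the summed descent inequality uniformly in [T]. *)
  pose A : R := average fs x0 - m + Lr * sigma ^+ 2 / 2 * eta_max ^+ 2 * C.
  have v0 : 0 <= Lr * sigma ^+ 2 / 2 * eta_max ^+ 2.
    by rewrite !mulr_ge0 ?exprn_ge0 ?invr_ge0// ltW.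
  have A0 : 0 <= A by rewrite addr_ge0 ?subr_ge0// mulr_ge0.
  have ck0 : 0 < c * kappa by rewrite mulr_gt0.
  (* The constant has to be positive while [A] is only known to be nonnegative, hence [A + 1]. *)
  apply/eqO_exP; exists ((A + 1) / (c * kappa)).
    by rewrite divr_gt0// ltr_wpDl.
  exists Tw.+1 => // T /= TwT.
  have lr_itv t : (t < T)%N -> 0 <= learning_rate warm (decay T) Tw t <= eta_max.
    move=> tT; rewrite /learning_rate; case: ltnP => [tTw|Twt]; last first.
      by rewrite decay_itv ?Twt.
    rewrite (ltW (warm_gt0 _ tTw))/= heta_max warm_homo//.
    by rewrite -ltnS prednK// tTw leqnn.
  have G0 := min_sqgrad_ge0 g Retr fs hPi (learning_rate warm (decay T) Tw) x0 hxi T.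
  rewrite (ger0_norm G0) ger0_norm ?invr_ge0 ?(ltW (D0 _ TwT))//.
  rewrite -mulrA -invfM ler_pdivlMr ?mulr_gt0 ?D0//.
  have := min_sqgrad_sum_le hLr hsmooth hPi hunbiased hvariance x0 hxi hb fm
    (ltnW TwT) lr_itv heta_max_lt.
  rewrite (eq_big_nat _ _ (F2 := decay T)); last first.
    by move=> t /andP[Twt _]; rewrite /learning_rate ltnNge Twt.
  have := ler_wpM2l G0 (ler_wpM2l (ltW c0) (decay_sum _ TwT)).
  have := ler_wpM2l v0 (sumbC T).
  rewrite -/c mulrA /A; lra.
have TTw0 T : (Tw < T)%N -> 0 < T%:R - Tw%:R :> R by rewrite subr_gt0 ltr_nat.
move=> G; split; last split.
- apply: (bound (fun=> decay_diminishing eta_max) _ eta_max) => // [T TwT|T t _|T TwT].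
  + by rewrite subr_gt0 ltr_sqrt// ltr_nat ltnS.
  + exact/decay_diminishing_itv/ltW.
  + by apply: sum_decay_diminishing_ge; [exact: ltW|exact: ltnW].
- apply: (bound (fun=> decay_constant eta_max) _ eta_max) => // [T t _|T TwT].
    by rewrite lexx ltW.
  by rewrite /decay_constant sumr_const_nat -[leRHS]mulr_natr natrB// ltnW.
(* One factor [1 / 2] is the lower bound on the weight, the other the proportion of steps on which
   it is used; the polynomial decay follows the same pattern. *)
- apply: (bound (decay_cosine eta_min eta_max Tw) _ (eta_max * (1 / 2 / 2))) => //.
  + by rewrite mulr_gt0//; lra.
  + by move=> T t _; rewrite decay_cosineE interpolation_itv// cosine_weight_itv.
  + move=> T TwT; under eq_bigr do rewrite decay_cosineE.
    apply: (sum_interpolation_ge (w := cosine_weight (T - Tw))) => //.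
    * exact: ltnW.
    * by move=> k _; apply: cosine_weight_itv.
    * by move=> k kT; apply: cosine_weight_ge; rewrite subn_gt0.
- apply: (bound (decay_polynomial eta_min eta_max p Tw) _
    (eta_max * (2^-1 `^ p / 2))) => //.
  + by rewrite mulr_gt0// divr_gt0// powR_gt0.
  + move=> T t /andP[Twt tT]; apply: interpolation_itv => //.
    by apply: polynomial_weight_itv => //; rewrite ltn_sub2r// (leq_ltn_trans Twt).
  + move=> T TwT; apply: (sum_interpolation_ge (w := polynomial_weight p (T - Tw))) => //.
    * exact: ltnW.
    * by move=> k; apply: polynomial_weight_itv.
    * by move=> k; apply: polynomial_weight_ge.
Qed.
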